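(* Let $(X,\Omega(X))$ be an arbitrary topological space and $(D,\sqsubseteq)$ a bounded-complete continuous domain, and let $\mathcal{W}$ be the rounded ideal completion of the abstract basis $(\mathcal{B},\vartriangleleft)$ of step functions. The maps $(\cdot)_*:[X\to D]\to\mathcal{W}$ and $(\cdot)^*:\mathcal{W}\to[X\to D]$ form a Galois connection in the category $\mathbf{Po}$ of posets and monotone maps, in which $(\cdot)_*$ is the right adjoint and $(\cdot)^*$ is the left adjoint; that is, both maps are monotone and $$\forall \phi\in\mathcal{W},\ \forall f\in[X\to D]:\quad \phi\subseteq f_* \iff \phi^*\sqsubseteq f .$$ Furthermore: (i) the map $(\cdot)^*$ is an epimorphism, and $(\cdot)_*$ is a monomorphism; (ii) $(\cdot)^*\circ(\cdot)_*=\mathrm{id}_{[X\to D]}$, i.e. $\forall f\in[X\to D]: (f_* )^*=f$; (iii) the left adjoint $(\cdot)^*$ is Scott continuous.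
   Context: Every dcpo is assumed pointed (bottom $\bot$). A domain is a continuous dcpo; $\ll$ is the way-below relation and $\Uparrow b=\{d\in D: b\ll d\}$. A poset is bounded-complete if each bounded pair has a supremum. A (domain-theoretic) basis of $D$ is a subset $B\subseteq D$ such that for each $x\in D$ the set $\{b\in B: b\ll x\}$ is directed with supremum $x$. $[X\to D]$ is the poset of functions continuous from $(X,\Omega(X))$ to $D$ with the Scott topology, ordered pointwise (a dcpo). Fix a base $B(X)$ of the topology $\Omega(X)$ and a basis $B(D)$ of $D$. For $O\in\Omega(X)$ and $b\in D$, the single-step function $b\chi_O:X\to D$ takes the value $b$ on $O$ and $\bot$ off $O$. $\mathcal{B}$ is the set of all (existing) finite suprema $\bigsqcup_{i\in I} b_i\chi_{O_i}$ with $I$ finite, $O_i\in B(X)$, $b_i\in B(D)$; the supremum exists iff for all $J\subseteq I$ with $\bigcap_{j\in J}O_j\neq\emptyset$ there is $b_J\in B(D)$ with $b_j\sqsubseteq b_J$ for all $j\in J$. On $\mathcal{B}$ define $$\bigsqcup_{i\in I} b_i\chi_{O_i}\vartriangleleft\theta' \iff \forall i\in I:\ O_i\subseteq(\theta')^{-1}(\Uparrow b_i),$$ which is independent of the chosen presentations. For arbitrary functions $f,g:X\to D$ define $f\vartriangleleft g$ iff there are $\theta_1,\theta_2\in\mathcal{B}$ with $f\sqsubseteq\theta_1\vartriangleleft\theta_2\sqsubseteq g$ (consistent with the definition on $\mathcal{B}$). The pair $(\mathcal{B},\vartriangleleft)$ is an abstract basis. A rounded ideal of $(\mathcal{B},\vartriangleleft)$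 is a non-empty $\phi\subseteq\mathcal{B}$ which is a lower set ($y\in\phi$, $x\vartriangleleft y$ imply $x\in\phi$) and such that for every finite $A\subseteq\phi$ there is $z\in\phi$ with $x\vartriangleleft z$ for all $x\in A$. $\mathcal{W}$ is the set of all rounded ideals of $(\mathcal{B},\vartriangleleft)$ ordered by inclusion. For $f\in[X\to D]$, $f_*=\{b\in\mathcal{B}: b\vartriangleleft f\}$. For $\phi\in\mathcal{W}$, $\phi^*=\bigsqcup_{b\in\phi}b\in[X\to D]$. *)

(* Defs.v *)
From HB Require Import structures.
From mathcomp Require Import all_boot all_order.
From mathcomp Require Import all_classical topology.

Set Implicit Arguments.
Unset Strict Implicit.
Unset Printing Implicit Defensive.

Import Order.Theory.
Local Open Scope classical_set_scope.
Local Open Scope order_scope.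

Section DomainTheory.
Context {d : Order.disp_t} {T : porderType d}.
Implicit Types (A B U : set T) (x y z : T).

Definition directed A :=
  A !=set0 /\
  forall x y, A x -> A y -> exists z, [/\ A z, x <= z & y <= z].

Definition way_below x y :=
  forall A s, directed A -> isLub A s -> y <= s -> exists2 a, A a & x <= a.

Definition way_above x : set T := [set y | way_below x y].

Definition domain_basis B :=
  forall x, directed [set b | B b /\ way_below b x] /\
            isLub [set b | B b /\ way_below b x] x.

Definition scott_open U :=
  (forall x y, U x -> x <= y -> U y) /\
  (forall A s, directed A -> isLub A s -> U s -> A `&` U !=set0).

Lemma directed_all (I : finType) (Q : I -> T -> Prop) A :
  directed A -> (forall i x y, Q i x -> x <= y -> Q i y) ->
  (forall i, exists2 a, A a & Q i a) ->
  exists2 a, A a & forall i, Q i a.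
Proof.
move=> [[a0 Aa0] dA] Qle AQ.
suff /(_ (enum I))[a Aa Qa] :
    forall s : seq I, exists2 a, A a & forall i, i \in s -> Q i a.
  by exists a => // i; apply: Qa; rewrite mem_enum.
elim=> [|i s [a Aa Qa]]; first by exists a0.
have [b Ab Qb] := AQ i; have [c [Ac ac bc]] := dA a b Aa Ab.
exists c => // j; rewrite inE => /orP[/eqP -> |js]; first exact: Qle Qb bc.
exact: Qle (Qa _ js) ac.
Qed.

Lemma way_below_le x y : way_below x y -> x <= y.
Proof.
move=> xy; have [_ -> //] : exists2 a, [set y] a & x <= a.
apply: (xy [set y] y) => //; last by split=> [_ ->|b]; [|exact].
by split; [exists y|move=> _ _ -> ->; exists y].
Qed.

Lemma le_way_below x y z : x <= y -> way_below y z -> way_below x z.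
Proof.
by move=> xy yz A s dA sA zs; have [a Aa ya] := yz A s dA sA zs;
  exists a => //; exact: le_trans ya.
Qed.

Lemma way_below_le_trans x y z : way_below x y -> y <= z -> way_below x z.
Proof. by move=> xy yz A s dA sA zs; apply: xy dA sA (le_trans yz zs). Qed.

Lemma way_below_lub (I : finType) (P : set I) (b : I -> T) s z :
  isLub (b @` P) s -> (forall i, P i -> way_below (b i) z) -> way_below s z.
Proof.
move=> [_ lubs] bz A t dA tA zt.
have [|i|a Aa ba] :=
    @directed_all I (fun i x => P i -> b i <= x) A dA.
- by move=> i x y bx xy Pi; exact: le_trans (bx Pi) xy.
- have [Pi|nPi] := pselect (P i).
    by have [a Aa bia] := bz i Pi A t dA tA zt; exists a.
  by have [[a Aa] _] := dA; exists a.
- by exists a => //; apply: lubs => _ [i Pi <-]; exact: ba.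
Qed.

Lemma way_below_interpolation B x z : domain_basis B -> way_below x z ->
  exists y, [/\ B y, way_below x y & way_below y z].
Proof.
move=> Bb xz.
pose A := [set c | B c /\ exists b, [/\ B b, way_below c b & way_below b z]].
have dA : directed A.
  split.
    have [[[b [Bb_ bz]] _] _] := Bb z; have [[[c [Bc cb]] _] _] := Bb b.
    by exists c; split=> //; exists b.
  move=> c1 c2 [Bc1 [b1 [Bb1 cb1 bz1]]] [Bc2 [b2 [Bb2 cb2 bz2]]].
  have [b [[Bb_ bz] b1b b2b]] :=
    (Bb z).1.2 b1 b2 (conj Bb1 bz1) (conj Bb2 bz2).
  have [c [[Bc cb] c1c c2c]] := (Bb b).1.2 c1 c2
    (conj Bc1 (way_below_le_trans cb1 b1b))
    (conj Bc2 (way_below_le_trans cb2 b2b)).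
  by exists c; split=> //; split=> //; exists b.
have zA : isLub A z.
  split=> [c [_ [b [_ cb bz]]]|u uA].
    exact: le_trans (way_below_le cb) (way_below_le bz).
  apply: (Bb z).2.2 => b [Bb_ bz]; apply: (Bb b).2.2 => c [Bc cb].
  by apply: uA; split=> //; exists b.
have [c [_ [b [Bb_ cb bz]]] xc] := xz A z dA zA (lexx z).
by exists b; split=> //; exact: le_way_below xc cb.
Qed.

End DomainTheory.

Definition is_dcpo d (T : porderType d) :=
  forall A : set T, directed A -> exists s, isLub A s.

Definition is_continuous d (T : porderType d) :=
  exists B : set T, domain_basis B.

Definition bounded_complete d (T : porderType d) :=
  forall x y : T, has_ubound [set x; y] -> exists s, isLub [set x; y] s.

(* Bounded-complete continuous domains; the bottom element comes from
   [Order.BPOrder]. *)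
HB.mixin Record isBCDomain d T of Order.BPOrder d T := {
  bcdomain_dcpo : is_dcpo T;
  bcdomain_continuous : is_continuous T;
  bcdomain_bounded_complete : bounded_complete T
}.

#[short(type="bcDomainType")]
HB.structure Definition BCDomain d := {T of Order.BPOrder d T & isBCDomain d T}.

Lemma bounded_finite_lub d (D : bcDomainType d) (I : finType) (P : set I)
    (b : I -> D) u :
  (forall i, P i -> b i <= u) -> exists s, isLub (b @` P) s.
Proof.
move=> bu.
suff /(_ (enum I))[s [ubs lubs]] : forall r : seq I, exists s,
    isLub (b @` [set i | i \in r /\ P i]) s.
  exists s; split=> [_ [i Pi <-]|v vP].
    by apply: ubs; exists i => //; rewrite /= mem_enum.
  by apply: lubs => _ [i [_ Pi] <-]; apply: vP; exists i.
elim=> [|i r [s [ubs lubs]]].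
  by exists \bot; split=> [_ [i []]//|v _]; exact: le0x.
have [Pi|nPi] := pselect (P i); last first.
  exists s; split=> [_ [j [+ Pj] <-]|v vP].
    rewrite inE => /orP[/eqP ij|jr]; first by rewrite ij in Pj.
    by apply: ubs; exists j.
  apply: lubs => _ [j [jr Pj] <-]; apply: vP; exists j => //.
  by split=> //; rewrite inE jr orbT.
have [|t [ubt lubt]] := @bcdomain_bounded_complete _ D (b i) s.
  exists u => _ [->|->]; first exact: bu.
  by apply: lubs => _ [j [_ Pj] <-]; exact: bu.
exists t; split=> [_ [j [+ Pj] <-]|v vP].
  rewrite inE => /orP[/eqP ->|jr]; first by apply: ubt; left.
  by apply: (le_trans (ubs _ _) (ubt s _)); [exists j|right].
apply: lubt => _ [->|->].
  by apply: vP; exists i => //; split=> //; rewrite inE eqxx.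
apply: lubs => _ [j [jr Pj] <-]; apply: vP; exists j => //.
by split=> //; rewrite inE jr orbT.
Qed.

(* [scott T] is a copy of the poset T carrying the Scott topology. *)
Definition scott (T : Type) : Type := T.

HB.instance Definition _ d (T : porderType d) := Order.POrder.copy (scott T) T.
HB.instance Definition _ d (T : bPOrderType d) :=
  Order.BPOrder.copy (scott T) T.

Section ScottTopology.
Context {d : Order.disp_t} {T : porderType d}.

Lemma scott_openT : scott_open [set: T].
Proof. by split=> // A s [[a Aa] _] _ _; exists a. Qed.

Lemma scott_openI : setI_closed (@scott_open d T).
Proof.
move=> U V [upU sU] [upV sV]; split.
  by move=> x y [Ux Vx] xy; split; [exact: upU xy|exact: upV xy].
move=> A s dA sA [Us Vs].
have [a [Aa Ua]] := sU A s dA sA Us.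
have [b [Ab Vb]] := sV A s dA sA Vs.
have [c [Ac ac bc]] := dA.2 a b Aa Ab.
by exists c; split=> //; split; [exact: upU ac|exact: upV bc].
Qed.

Lemma scott_open_bigU (I : Type) (f : I -> set T) :
  (forall i, scott_open (f i)) -> scott_open (\bigcup_i f i).
Proof.
move=> of_; split.
  by move=> x y [i _ fix_] xy; exists i => //; apply: (of_ i).1 xy.
move=> A s dA sA [i _ fis]; have [a [Aa fa]] := (of_ i).2 A s dA sA fis.
by exists a; split=> //; exists i.
Qed.

HB.instance Definition _ :=
  isOpenTopological.Build (scott T) scott_openT scott_openI scott_open_bigU.

End ScottTopology.

(* [X -> D], ordered pointwise *)
Section ContinuousOrder.
Context {X : topologicalType} {d : Order.disp_t} {D : porderType d}.
Local Notation F := (continuousType X (scott D)).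

Definition cts_le (f g : F) : bool := (f : X -> D) <= (g : X -> D).

Lemma cts_le_refl : reflexive cts_le.
Proof. by move=> f; exact: lexx. Qed.

Lemma cts_le_anti : antisymmetric cts_le.
Proof. by move=> f g /le_anti fg; apply/continuousEP => x; rewrite fg. Qed.

Lemma cts_le_trans : transitive cts_le.
Proof. by move=> g f h; exact: le_trans. Qed.

HB.instance Definition _ := Order.Le_isPOrder.Build FunOrder.fun_display F
  cts_le_refl cts_le_anti cts_le_trans.

End ContinuousOrder.

Definition rounded_ideal (S : Type) (B : set S) (R : S -> S -> Prop)
    (phi : set S) :=
  [/\ phi `<=` B, phi !=set0,
      forall x y, B x -> phi y -> R x y -> phi x &
      forall A, finite_set A -> A `<=` phi ->
        exists2 z, phi z & forall x, A x -> R x z].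

Record roundedIdeal (S : Type) (B : set S) (R : S -> S -> Prop) :=
  RoundedIdeal { ideal_set :> set S; idealP : rounded_ideal B R ideal_set }.

Section RoundedIdealOrder.
Context {S : Type} {B : set S} {R : S -> S -> Prop}.
Local Notation W := (roundedIdeal B R).

HB.instance Definition _ := gen_eqMixin W.
HB.instance Definition _ := gen_choiceMixin W.

Definition ideal_le (phi psi : W) : bool := `[< phi `<=` psi >].

Lemma ideal_le_refl : reflexive ideal_le.
Proof. by move=> phi; apply/asboolP. Qed.

Lemma ideal_le_anti : antisymmetric ideal_le.
Proof.
move=> [p hp] [q hq] /andP[/asboolP/= pq /asboolP/= qp].
have e : p = q by apply/seteqP.
by rewrite e in hp *; congr RoundedIdeal; exact: Prop_irrelevance.
Qed.

Lemma ideal_le_trans : transitive ideal_le.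
Proof.
move=> q p r /asboolP pq /asboolP qr; apply/asboolP.
exact: subset_trans pq qr.
Qed.

HB.instance Definition _ := Order.Le_isPOrder.Build Order.default_display W
  ideal_le_refl ideal_le_anti ideal_le_trans.

End RoundedIdealOrder.

Section StepFunctions.
Context {X : topologicalType} {d : Order.disp_t} {D : bcDomainType d}.
Context (BX : set (set X)) (BD : set D).
Implicit Types (f g theta : X -> D).

Definition single_step (b : D) (O : set X) : X -> D :=
  fun x => if x \in O then b else \bot.

(* theta is the supremum, for the pointwise order, of b_i chi_(O_i) *)
Definition presents (I : finType) (b : I -> D) (O : I -> set X) theta :=
  (forall i, BX (O i) /\ BD (b i)) /\
  isLub (range (fun i => single_step (b i) (O i))) theta.

(* I may be empty, so that the constant function \bot is a step function *)
Definition step_fun : set (X -> D) :=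
  [set theta | exists (I : finType) (b : I -> D) (O : I -> set X),
    presents b O theta].

(* see [step_tri_presents] below for the independence of the presentation of theta *)
Definition step_tri theta theta' :=
  step_fun theta' /\
  exists (I : finType) (b : I -> D) (O : I -> set X),
    presents b O theta /\ forall i, O i `<=` theta' @^-1` way_above (b i).

Definition tri f g :=
  exists theta1 theta2, [/\ step_fun theta1, step_fun theta2,
    f <= theta1, step_tri theta1 theta2 & theta2 <= g].

Definition stepIdeal := roundedIdeal step_fun step_tri.

Definition lower_star_set f : set (X -> D) :=
  [set b | step_fun b /\ tri b f].

(* The supremum is taken in [X -> D]. When the sets of BX are open, every
   element of phi is in [X -> D] and the supremum exists and is pointwise: see
   [step_fun_continuous] and [upper_star_lub]. *)
Definition upper_star (phi : stepIdeal) : continuousType X (scott D) :=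
  supremum (cst \bot : continuousType X (scott D))
    [set g : continuousType X (scott D) | ideal_set phi (g : X -> D)].

Lemma bounded_presents (I : finType) (b : I -> D) (O : I -> set X) f :
  (forall i, BX (O i) /\ BD (b i)) -> (forall i x, O i x -> b i <= f x) ->
  exists2 theta, presents b O theta &
    forall x, isLub (b @` [set i | O i x]) (theta x).
Proof.
move=> BbO bf.
have /choice[theta lubt] x : exists y, isLub (b @` [set i | O i x]) y.
  by apply: (@bounded_finite_lub _ _ _ _ _ (f x)) => i; exact: bf.
exists theta => //; split=> //; split=> [_ [i _ <-]|g ubg]; apply/lefP => x.
  rewrite /single_step; case: ifPn => [/set_mem Oix|_]; last exact: le0x.
  by apply: (lubt x).1; exists i.
apply: (lubt x).2 => _ [i Oix <-].
have /lefP/(_ x) : single_step (b i) (O i) <= g by apply: ubg; exists i.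
by rewrite /single_step mem_set.
Qed.

Lemma presents_lub (I : finType) (b : I -> D) (O : I -> set X) theta :
  presents b O theta -> forall x, isLub (b @` [set i | O i x]) (theta x).
Proof.
move=> [BbO [ubt lubt]].
have bt i x : O i x -> b i <= theta x.
  move=> Oix; have /lefP/(_ x) : single_step (b i) (O i) <= theta.
    by apply: ubt; exists i.
  by rewrite /single_step mem_set.
have [theta' [_ [ubt' lubt']] lub'] := bounded_presents BbO bt.
suff -> : theta = theta' by [].
by apply/le_anti; rewrite lubt// lubt'.
Qed.

Lemma step_triE theta theta' : step_fun theta -> step_fun theta' ->
  step_tri theta theta' <-> forall x, way_below (theta x) (theta' x).
Proof.
move=> [I [b [O btheta]]] st'; split.
  move=> [_ [J [c [U [ctheta cU]]]]] x.
  by apply: way_below_lub (presents_lub ctheta x) _ => j; exact: cU.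
move=> tt'; split=> //; exists I, b, O; split=> // i x Oix.
apply: le_way_below (tt' x).
by apply: (presents_lub btheta x).1; exists i.
Qed.

Lemma step_tri_presents (I : finType) (b : I -> D) (O : I -> set X)
    theta theta' :
  presents b O theta -> step_fun theta' ->
  step_tri theta theta' <-> forall i, O i `<=` theta' @^-1` way_above (b i).
Proof.
move=> btheta st'; split; last by move=> bO; split=> //; exists I, b, O.
move/step_triE => -/(_ (ex_intro _ I (ex_intro _ b (ex_intro _ O btheta))) st').
move=> tt' i x Oix; apply: le_way_below (tt' x).
by apply: (presents_lub btheta x).1; exists i.
Qed.

Lemma step_fun_join f theta1 theta2 :
  step_fun theta1 -> step_fun theta2 -> theta1 <= f -> theta2 <= f ->
  exists2 theta, step_fun theta &
    forall x, isLub [set theta1 x; theta2 x] (theta x).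
Proof.
move=> [I [b [O bO]]] [J [c [U cU]]] /lefP t1f /lefP t2f.
pose bc k := match k with inl i => b i | inr j => c j end.
pose OU k := match k with inl i => O i | inr j => U j end.
have [[i|j]|[i|j] x /=|theta ptheta lubt] := @bounded_presents _ bc OU f.
- exact: bO.1.
- exact: cU.1.
- move=> Oix; apply: le_trans (t1f x).
  by apply: (presents_lub bO x).1; exists i.
- move=> Ujx; apply: le_trans (t2f x).
  by apply: (presents_lub cU x).1; exists j.
exists theta => [|x]; first by exists _, bc, OU.
split=> [_ [->|->]|u ub_u].
- apply: (presents_lub bO x).2 => _ [i Oix <-].
  by apply: (lubt x).1; exists (inl i).
- apply: (presents_lub cU x).2 => _ [j Ujx <-].
  by apply: (lubt x).1; exists (inr j).
apply: (lubt x).2 => _ [[i|j] /= h <-].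
  apply: le_trans (ub_u (theta1 x) _); last by left.
  by apply: (presents_lub bO x).1; exists i.
apply: le_trans (ub_u (theta2 x) _); last by right.
by apply: (presents_lub cU x).1; exists j.
Qed.

Context (BD_basis : domain_basis BD).

Lemma step_fun_interpolation theta theta' :
  step_fun theta -> step_fun theta' ->
  (forall x, way_below (theta x) (theta' x)) ->
  exists2 z, step_fun z &
    forall x, way_below (theta x) (z x) /\ way_below (z x) (theta' x).
Proof.
move=> [I [e [U eU]]] [J [b [O bO]]] tt'.
pose C := [set c : J -> D | forall j, BD (c j) /\ way_below (c j) (b j)].
have C0 : C !=set0.
  have /choice[c Cc] j : exists t, BD t /\ way_below t (b j).
    by have [[[t]]] := BD_basis (b j); exists t.
  by exists c.
have dC : directed C.
  split=> // c1 c2 Cc1 Cc2.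
  have /choice[c Cc] j : exists t,
      [/\ BD t /\ way_below t (b j), c1 j <= t & c2 j <= t].
    exact: (BD_basis (b j)).1.2.
  exists c; split; first by move=> j; have [] := Cc j.
    by apply/lefP => j; have [] := Cc j.
  by apply/lefP => j; have [] := Cc j.
pose Q (p : I * {set J}) (c : J -> D) :=
  (exists2 x, U p.1 x & [set j | j \in p.2] = [set j | O j x]) ->
  forall u, (forall j, j \in p.2 -> c j <= u) -> way_below (e p.1) u.
have [|[i K]|c Cc Qc] := @directed_all _ _ _ Q C dC.
- move=> p c c' Qc /lefP cc' hx u c'u; apply: (Qc hx u) => j jK.
  by apply: le_trans (cc' j) _; exact: c'u.
- have [[/= x Uix KO]|nx] := pselect (exists2 x, U i x &
      [set j | j \in K] = [set j | O j x]); last first.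
    by have [c Cc] := C0; exists c => // /nx.
  have lubx := presents_lub bO x; rewrite -KO in lubx.
  have bx j : j \in K -> b j <= theta' x.
    by move=> jK; apply: lubx.1; exists j.
  have lubC c : C c -> exists l, isLub (c @` [set j | j \in K]) l.
    move=> Cc; apply: (@bounded_finite_lub _ _ _ _ _ (theta' x)) => j jK.
    exact: le_trans (way_below_le (Cc j).2) (bx j jK).
  pose A := [set l | exists2 c, C c & isLub (c @` [set j | j \in K]) l].
  have dA : directed A.
    split.
      by have [c Cc] := C0; have [l lub_l] := lubC c Cc; exists l, c.
    move=> l1 l2 [c1 Cc1 lub1] [c2 Cc2 lub2].
    have [c [Cc /lefP c1c /lefP c2c]] := dC.2 _ _ Cc1 Cc2.
    have [l lub_l] := lubC c Cc; exists l; split; first by exists c.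
      apply: lub1.2 => _ [j jK <-]; apply: le_trans (c1c j) _.
      by apply: lub_l.1; exists j.
    apply: lub2.2 => _ [j jK <-]; apply: le_trans (c2c j) _.
    by apply: lub_l.1; exists j.
  have lubA : isLub A (theta' x).
    split=> [l [c Cc lub_l]|v ubv].
      apply: lub_l.2 => _ [j jK <-].
      exact: le_trans (way_below_le (Cc j).2) (bx j jK).
    apply: lubx.2 => _ [j jK <-]; apply: (BD_basis (b j)).2.2 => t [BDt tb].
    have [c0 Cc0] := C0; pose c k := if k == j then t else c0 k.
    have Cc : C c.
      by move=> k; rewrite /c; case: eqP => [->|_]; [|exact: Cc0].
    have [l lub_l] := lubC c Cc.
    apply: (@le_trans _ _ l); last by apply: ubv; exists c.
    by apply: lub_l.1; exists j => //; rewrite /c eqxx.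
  have ei : way_below (e i) (theta' x).
    by apply: le_way_below (tt' x); apply: (presents_lub eU x).1; exists i.
  have [y [_ eiy yt]] := way_below_interpolation BD_basis ei.
  have [l [c Cc lub_l] yl] := yt A _ dA lubA (lexx _).
  exists c => // _ u cu; apply: way_below_le_trans eiy _.
  by apply: le_trans yl _; apply: lub_l.2 => _ [j jK <-]; exact: cu.
have [j|j x Ojx|z pz lubz] := @bounded_presents _ c O theta'.
- by split; [exact: (bO.1 j).1|exact: (Cc j).1].
- apply: le_trans (way_below_le (Cc j).2) _.
  by apply: (presents_lub bO x).1; exists j.
exists z => [|x]; first by exists J, c, O.
split.
  apply: way_below_lub (presents_lub eU x) _ => i Uix.
  apply: (Qc (i, [set j | `[< O j x >]]%SET)) => /=.
    exists x => //; apply/seteqP; split=> j /=; rewrite inE.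
      by move/asboolP.
    by move=> Ojx; apply/asboolP.
  by move=> j; rewrite inE => /asboolP Ojx; apply: (lubz x).1; exists j.
apply: way_below_lub (lubz x) _ => j Ojx.
apply: way_below_le_trans (Cc j).2 _.
by apply: (presents_lub bO x).1; exists j.
Qed.

Lemma bot_step_fun : step_fun (cst \bot).
Proof.
exists void, (fun v : void => match v with end),
  (fun v : void => match v with end).
split=> [[]|]; split=> [_ [[]]|g _].
by apply/lefP => x; exact: le0x.
Qed.

Lemma tri_way_below theta f : step_fun theta ->
  tri theta f <-> exists theta', [/\ step_fun theta',
    forall x, way_below (theta x) (theta' x) & theta' <= f].
Proof.
move=> st; split.
  move=> [t1 [t2 [st1 st2 /lefP tt1 t12 t2f]]]; exists t2; split=> // x.
  by apply: le_way_below (tt1 x) _; apply: (step_triE st1 st2).1.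
move=> [t' [st' tt' t'f]]; exists theta, t'; split=> //.
exact/step_triE.
Qed.

Lemma tri_step_fun theta theta' : step_fun theta -> step_fun theta' ->
  tri theta theta' <-> step_tri theta theta'.
Proof.
move=> st st'; split; last by move=> tt'; exists theta, theta'; split.
move=> /(tri_way_below _ st)[t [_ wt /lefP tt']].
by apply/step_triE => // x; exact: way_below_le_trans (wt x) (tt' x).
Qed.

Lemma lower_star_rounded f :
  rounded_ideal step_fun step_tri (lower_star_set f).
Proof.
have lower0 : lower_star_set f (cst \bot).
  split; first exact: bot_step_fun.
  apply/(tri_way_below _ bot_step_fun); exists (cst \bot); split=> [|x|].
  - exact: bot_step_fun.
  - move=> A s [[a Aa] _] _ _; exists a => //; exact: le0x.
  - by apply/lefP => x; exact: le0x.
have pair a b : lower_star_set f a -> lower_star_set f b ->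
    exists z, [/\ lower_star_set f z, step_tri a z & step_tri b z].
  move=> [sa /(tri_way_below _ sa)[t1 [st1 at1 t1f]]].
  move=> [sb /(tri_way_below _ sb)[t2 [st2 bt2 t2f]]].
  have [t st lubt] := step_fun_join st1 st2 t1f t2f.
  have [z1 sz1 wz1] := step_fun_interpolation sa st1 at1.
  have [z2 sz2 wz2] := step_fun_interpolation sb st2 bt2.
  have t1t x : t1 x <= t x by apply: (lubt x).1; left.
  have t2t x : t2 x <= t x by apply: (lubt x).1; right.
  have [||z sz lubz] := @step_fun_join t _ _ sz1 sz2.
  - by apply/lefP => x; exact: le_trans (way_below_le (wz1 x).2) (t1t x).
  - by apply/lefP => x; exact: le_trans (way_below_le (wz2 x).2) (t2t x).
  exists z; split.
  - split=> //; apply/(tri_way_below _ sz); exists t; split=> //.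
      move=> x; pose zz (i : bool) := if i then z1 x else z2 x.
      apply: (@way_below_lub _ _ _ [set: bool] zz).
        split=> [_ [[] _ <-]|u ub_u]; rewrite /zz.
        - by apply: (lubz x).1; left.
        - by apply: (lubz x).1; right.
        - apply: (lubz x).2 => _ [->|->]; apply: ub_u.
            by exists true.
          by exists false.
      case=> _; rewrite /zz.
        exact: way_below_le_trans (wz1 x).2 (t1t x).
      exact: way_below_le_trans (wz2 x).2 (t2t x).
    apply/lefP => x; apply: (lubt x).2 => _ [->|->].
      by move/lefP: t1f.
    by move/lefP: t2f.
  - apply/(step_triE sa sz) => x; apply: way_below_le_trans (wz1 x).1 _.
    by apply: (lubz x).1; left.
  - apply/(step_triE sb sz) => x; apply: way_below_le_trans (wz2 x).1 _.
    by apply: (lubz x).1; right.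
split; first by move=> g [].
- by exists (cst \bot).
- move=> x y sx [sy /(tri_way_below _ sy)[t [st yt tf]]].
  move=> /(step_triE sx sy) xy; split=> //.
  apply/(tri_way_below _ sx); exists t; split=> // u.
  exact: le_way_below (way_below_le (xy u)) (yt u).
move=> A /finite_seqP[s ->].
elim: s => [|a s IHs] sf; first by exists (cst \bot).
have [z fz sz] : exists2 z, lower_star_set f z &
    forall x, [set` s] x -> step_tri x z.
  by apply: IHs => x xs; apply: sf; rewrite /= inE [_ \in _]xs orbT.
have [|w [fw aw zw]] := pair a z _ fz.
  by apply: sf; rewrite /= inE eqxx.
exists w => // x /=; rewrite inE => /orP[/eqP -> //|xs].
have [sx _] : lower_star_set f x.
  by apply: sf; rewrite /= inE xs orbT.
apply/(step_triE sx fw.1) => u.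
apply: le_way_below (way_below_le _) ((step_triE fz.1 fw.1).1 zw u).
exact: (step_triE sx fz.1).1 (sz x xs) u.
Qed.

Definition lower_star (f : continuousType X (scott D)) : stepIdeal :=
  RoundedIdeal (lower_star_rounded f).

End StepFunctions.

Section UpperStar.
Context {X : topologicalType} {d : Order.disp_t} {D : bcDomainType d}.
Context (BX : set (set X)) (BD : set D).
Context (BX_base : basis BX).

Lemma step_fun_continuous (theta : X -> D) :
  step_fun BX BD theta -> continuous (theta : X -> scott D).
Proof.
move=> [I [b [O bO]]]; apply/continuousP => U oU.
have {}oU : scott_open (U : set D) := oU.
rewrite openE => x /= Ux.
have : \forall y \near x, forall i, O i x -> O i y.
  apply: filter_forall => i; have [Oix|nOix] := pselect (O i x); last first.
    by apply: nearW => y.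
  have : nbhs x (O i).
    by apply: open_nbhs_nbhs; split=> //; exact: BX_base.1 _ (bO.1 i).1.
  exact: filterS.
apply: filterS => y xy; apply: oU.1 Ux _.
apply: (presents_lub bO x).2 => _ [i Oix <-].
by apply: (presents_lub bO y).1; exists i => //; exact: xy.
Qed.

Lemma ideal_directed (phi : stepIdeal BX BD) (t1 t2 : X -> D) :
  ideal_set phi t1 -> ideal_set phi t2 ->
  exists t, [/\ ideal_set phi t, t1 <= t & t2 <= t].
Proof.
have [sphi _ _ dphi] := idealP phi => p1 p2.
have [||t pt tt] := dphi [set t1; t2].
- exact: finite_set2.
- by move=> _ [->|->].
have le_t u : [set t1; t2] u -> u <= t.
  move=> ut; apply/lefP => x; apply: way_below_le.
  apply: (step_triE _ _).1 (tt u ut) x; last exact: sphi.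
  by apply: sphi; case: ut => ->.
by exists t; split=> //; apply: le_t; [left|right].
Qed.

Lemma upper_star_lub (phi : stepIdeal BX BD) x :
  isLub [set t x | t in ideal_set phi] (upper_star phi x).
Proof.
have [sphi [t0 pt0] _ _] := idealP phi.
have /choice[g lubg] y : exists s : D, isLub [set t y | t in ideal_set phi] s.
  apply: bcdomain_dcpo; split; first by exists (t0 y); exists t0.
  move=> _ _ [t1 p1 <-] [t2 p2 <-].
  have [t [pt /lefP t1t /lefP t2t]] := ideal_directed p1 p2.
  by exists (t y); split=> //; exists t.
have cg : continuous (g : X -> scott D).
  apply/continuousP => U oU.
  have sU : scott_open (U : set D) := oU.
  rewrite openE => y /= Uy.
  have [|_ [[t pt <-] Ut]] := sU.2 _ _ _ (lubg y) Uy.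
    split; first by exists (t0 y); exists t0.
    move=> _ _ [t1 p1 <-] [t2 p2 <-].
    have [t [pt /lefP t1t /lefP t2t]] := ideal_directed p1 p2.
    by exists (t y); split=> //; exists t.
  have ct := step_fun_continuous (sphi _ pt).
  have /continuousP/(_ U oU) := ct; rewrite openE => /(_ y Ut).
  apply: filterS => z Utz; apply: sU.1 Utz _.
  by apply: (lubg z).1; exists t.
pose G : continuousType X (scott D) := mkcts cg.
have lubG : supremums [set h : continuousType X (scott D) | ideal_set phi h] G.
  split=> [h ph|h uh]; apply/lefP => y.
    by apply: (lubg y).1; exists h.
  apply: (lubg y).2 => _ [t pt <-].
  pose t' : continuousType X (scott D) :=
    mkcts (step_fun_continuous (sphi _ pt)).
  by have /lefP/(_ y) := uh t' pt.
suff -> : upper_star phi = G by exact: lubg.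
rewrite /upper_star /supremum ifF; last first.
  apply/negP => /eqP/seteqP[+ _].
  by move=> /(_ (mkcts (step_fun_continuous (sphi _ pt0)))); apply.
apply: (is_subset1_supremums _ lubG); exact: xgetI lubG.
Qed.
End UpperStar.

Definition scott_continuous d d' (T : porderType d) (T' : porderType d')
    (f : T -> T') :=
  forall (A : set T) s, directed A -> isLub A s -> isLub (f @` A) (f s).

(* Epimorphisms and monomorphisms of the category of posets and monotone maps;
   f itself is not required to be monotone here *)
Definition po_epimorphism d d' (T : porderType d) (T' : porderType d')
    (f : T -> T') :=
  forall d'' (P : porderType d'') (g h : {omorphism T' -> P}),
    g \o f =1 h \o f -> g =1 h.

Definition po_monomorphism d d' (T : porderType d) (T' : porderType d')
    (f : T -> T') :=
  forall d'' (P : porderType d'') (g h : {omorphism P -> T}),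
    f \o g =1 f \o h -> g =1 h.

(* Main.v *)
Require Import Defs.
From mathcomp Require Import all_boot all_order.
From mathcomp Require Import all_classical topology.

Import Order.Theory.
Local Open Scope classical_set_scope.
Local Open Scope order_scope.

(** The adjunction comes from roundedness: if t belongs to phi, then some z in
    phi satisfies t <| z <= phi^*, so t <| f as soon as phi^* <= f.  To recover
    f from its lower set, take b << c << f x with b and c in the basis of D: the
    preimage under f of the Scott-open set of points way above c contains a
    basic neighbourhood O of x, and b chi_O <| c chi_O <= f.  The remaining
    claims are formal: a split epi (mono) is an epi (mono), and a left adjoint
    preserves all existing suprema. *)

(** Interpolation gives [y] strictly between [x] and the supremum [s]; some member of [A] is then
    above [y], hence way above [x]. *)
Lemma scott_open_way_above d (T : porderType d) (B : set T) (x : T) :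
  domain_basis B -> scott_open (way_above x).
Proof.
move=> BB; split=> [y z xy yz|A s dA lubA xs].
  exact: way_below_le_trans xy yz.
have [y [_ xy ys]] := way_below_interpolation BB xs.
have [a Aa ya] := ys A s dA lubA (lexx s).
by exists a; split=> //; exact: way_below_le_trans xy ya.
Qed.

Lemma way_below_bot d (T : bPOrderType d) (x : T) : way_below \bot x.
Proof. by move=> A s [[a Aa] _] _ _; exists a => //; exact: le0x. Qed.

Section StepApproximation.
Set Implicit Arguments.
Unset Strict Implicit.
Context {X : topologicalType} {d : Order.disp_t} {D : bcDomainType d}.
Context {BX : set (set X)} {BD : set D}.

Lemma single_step_step_fun (b : D) (O : set X) :
  BX O -> BD b -> step_fun BX BD (single_step b O).
Proof.
move=> BXO BDb; exists unit, (fun=> b), (fun=> O).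
split=> //; split=> [_ [_ _ <-]//|g ubg].
by apply: ubg; exists tt.
Qed.

Lemma tri_le (f g : X -> D) : tri BX BD f g -> f <= g.
Proof.
move=> [t1 [t2 [st1 st2 ft1 t12 t2g]]].
apply: le_trans ft1 (le_trans _ t2g); apply/lefP => x.
exact: way_below_le ((step_triE st1 st2).1 t12 x).
Qed.

Lemma lower_star_single_step (f : X -> D) (b c : D) (O : set X) :
  BX O -> BD b -> BD c -> way_below b c -> O `<=` f @^-1` way_above c ->
  lower_star_set BX BD f (single_step b O).
Proof.
move=> BXO BDb BDc bc Oc.
have sb := single_step_step_fun BXO BDb.
split=> //; apply/(tri_way_below _ sb); exists (single_step c O).
split=> [|x|]; first exact: single_step_step_fun.
(* Off [O] both step functions take the value [\bot], which is way below itself. *)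
- by rewrite /single_step; case: ifP => // _; exact: way_below_bot.
- apply/lefP => x; rewrite /single_step.
  case: ifPn => [/set_mem/Oc/way_below_le//|_]; exact: le0x.
Qed.

Context (BX_base : basis BX) (BD_basis : domain_basis BD).

Lemma lower_star_lub (f : X -> D) (x : X) :
  continuous (f : X -> scott D) ->
  isLub [set t x | t in lower_star_set BX BD f] (f x).
Proof.
move=> cf; split=> [_ [t [_ /tri_le/lefP tf] <-]|u ubu]; first exact: tf.
(* As [f x] is the supremum of the basis elements way below it, it suffices to bound each such [b]
   by [u]. *)
apply: (BD_basis (f x)).2.2 => b [BDb bfx].
have [c [BDc bc cfx]] := way_below_interpolation BD_basis bfx.
have /cf : nbhs (f x : scott D) (way_above c).
  apply: open_nbhs_nbhs; split=> //.
  exact: scott_open_way_above _ _ _ _ BD_basis.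
move=> /(BX_base.2 x) [O [BXO Ox] Oc].
apply: ubu; exists (single_step b O).
  exact: lower_star_single_step bc Oc.
by rewrite /single_step mem_set.
Qed.

Lemma upper_star_adjunction (phi : stepIdeal BX BD)
    (f : continuousType X (scott D)) :
  ideal_set phi `<=` lower_star_set BX BD f <-> upper_star phi <= f.
Proof.
split=> [phif|/lefP phif t pt].
  apply/lefP => x; apply: (upper_star_lub BX_base phi x).2 => _ [t pt <-].
  by have [_ /tri_le/lefP] := phif t pt.
have [sphi _ _ rphi] := idealP phi; have st := sphi t pt.
have [||z pz tz] := rphi [set t]; [exact: finite_set1|by move=> _ ->|].
split=> //; apply/(tri_way_below _ st); exists z.
split; [exact: sphi|exact/(step_triE st (sphi z pz))/tz|].
apply/lefP => x; apply: le_trans (phif x).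
by apply: (upper_star_lub BX_base phi x).1; exists z.
Qed.

Lemma upper_star_lower_star (f : continuousType X (scott D)) :
  upper_star (lower_star BX BD_basis f) = f.
Proof.
apply/continuousEP => x.
have lubf := lower_star_lub x (@cts_fun _ _ f).
have lubu := upper_star_lub BX_base (lower_star BX BD_basis f) x.
(* Both values are suprema of one and the same set, so they coincide. *)
by apply: le_anti; rewrite (lubu.2 _ lubf.1) (lubf.2 _ lubu.1).
Qed.

End StepApproximation.

(** An upper bound [y] of the image of [A] transposes to the upper bound [r y] of [A], so
    [s <= r y], that is, [l s <= y]. *)
Lemma left_adjoint_scott_continuous d d' (T : porderType d) (T' : porderType d')
    (l : T -> T') (r : T' -> T) :
  (forall x y, x <= r y <-> l x <= y) -> scott_continuous l.
Proof.
move=> adj A s _ [ubs lubs]; split=> [_ [a Aa <-]|y uby].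
  (* The unit [s <= r (l s)] yields [a <= r (l s)]. *)
  by apply/adj/(le_trans (ubs a Aa))/adj.
by apply/adj/lubs => a Aa; apply/adj/uby; exists a.
Qed.

Theorem theorem3p15 (X : topologicalType) (d : Order.disp_t)
    (D : bcDomainType d) (BX : set (set X)) (BD : set D)
    (BX_base : basis BX) (BD_basis : domain_basis BD) :
  let F := continuousType X (scott D) in
  let W := stepIdeal BX BD in
  let lower : F -> W := lower_star BX BD_basis in
  let upper : W -> F := @upper_star X d D BX BD in
  [/\ {homo lower : f g / f <= g} /\ {homo upper : phi psi / phi <= psi},
      forall (phi : W) (f : F),
        ideal_set phi `<=` ideal_set (lower f) <-> upper phi <= f,
      po_epimorphism upper /\ po_monomorphism lower,
      upper \o lower = id
    & scott_continuous upper].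
Proof.
move=> F W lower upper.
have upperK (f : F) : upper (lower f) = f.
  exact: upper_star_lower_star.
have galois (phi : W) (f : F) :
    ideal_set phi `<=` ideal_set (lower f) <-> upper phi <= f.
  exact: upper_star_adjunction.
have adj (phi : W) (f : F) : phi <= lower f <-> upper phi <= f.
  by rewrite -galois; split=> /asboolP.
split=> //; [split|split| |].
- by move=> f g fg; apply/adj; rewrite upperK.
- by move=> phi psi le_phi; apply/adj/(le_trans le_phi)/adj.
(* Each [f] is the image under [upper] of [lower f], where [gh] applies. *)
- by move=> d'' P g h gh f; rewrite -(upperK f); exact: gh.
- move=> d'' P g h gh p; rewrite -[g p]upperK -[h p]upperK.
  by congr upper; exact: gh.
- exact/funext.
- exact: left_adjoint_scott_continuous _ _ _ _ _ _ adj.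
Qed.
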